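(* Let $\Lambda\subset\mathbb{R}^d$ be a lattice and let $(X_N)_{N\in\mathbb{N}}$ be a sequence of point sets in $\Omega_\Lambda$ which is hyperuniform for balls of threshold order. Then $(X_N)_{N\in\mathbb{N}}$ is uniformly distributed on $\Omega_\Lambda$.
   Context: Let $\Lambda=A\mathbb{Z}^d$ be a lattice in $\mathbb{R}^d$, generated by a nonsingular matrix $A=[v_1,\dots,v_d]$, with fundamental domain $\Omega_\Lambda=\{\sum_{j=1}^d\alpha_jv_j:\alpha_j\in[0,1)\}$ of $\mathbb{R}^d/\Lambda$ and co-volume $|\Lambda|=|\det A|$. Let $\mu$ be Lebesgue measure on $\Omega_\Lambda$ normalized so that $\mu(\Omega_\Lambda)=1$, and let $\mathrm{diam}\,\Omega_\Lambda$ be the Euclidean diameter. A sequence of point sets $(X_N)_{N\in\mathbb{N}}$ has $X_N=\{\mathbf{x}_1,\dots,\mathbf{x}_N\}\subset\Omega_\Lambda$ with $\#X_N=N$; the points $\mathbf{x}_j=\mathbf{x}_j^{(N)}$ may depend on $N$. Balls on the torus: indicator functions of balls are $\Lambda$-periodized, i.e. for $\mathbf{x},\mathbf{y}\in\mathbb{R}^d$ and $R\ge 0$ put $\mathbb{1}_{B(\mathbf{x},R)}(\mathbf{y})=\#\{v\in\Lambda:|\mathbf{y}+v-\mathbf{x}|\le R\}$, and $\mathrm{Vol}(B(\mathbf{x},R))=\frac{1}{|\Lambda|}\frac{\pi^{d/2}}{\Gamma(d/2+1)}R^d$ (so this is the $\mu$-mean of $\mathbb{1}_{B(\mathbf{x},R)}$).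 Uniform distribution: $(X_N)$ is uniformly distributed on $\Omega_\Lambda$ if $\lim_{N\to\infty}\frac1N\sum_{j=1}^N\mathbb{1}_{B(\mathbf{x},R)}(\mathbf{x}_j)=\mathrm{Vol}(B(\mathbf{x},R))$ for all $\mathbf{x}\in\mathbb{R}^d$ and $R\in[0,\frac12\mathrm{diam}\,\Omega_\Lambda]$. Number variance: $V(X_N,R)=\int_{\Omega_\Lambda}\big(\sum_{j=1}^N\mathbb{1}_{B(\mathbf{x},R)}(\mathbf{x}_j)-N\,\mathrm{Vol}(B(\mathbf{x},R))\big)^2d\mu(\mathbf{x})$. $(X_N)$ is hyperuniform for balls of threshold order if $\limsup_{N\to\infty}V(X_N,tN^{-1/d})=\mathcal{O}(t^{d-1})$ as $t\to\infty$. *)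

(* Defs.v *)
From HB Require Import structures.
From mathcomp Require Import all_boot all_order all_algebra finmap.
From mathcomp Require Import all_classical all_reals all_analysis.

Set Implicit Arguments.
Unset Strict Implicit.
Unset Printing Implicit Defensive.

Import Order.TTheory GRing.Theory Num.Theory.
Import numFieldNormedType.Exports.

Local Open Scope classical_set_scope.
Local Open Scope ring_scope.

(* The product sigma-algebra on column vectors, defined from the coordinate
   maps exactly as the library does for tuples; over a [realType] it is the
   Borel sigma-algebra of R^n. *)
Definition measure_cV_display : measure_display -> measure_display.
Proof. exact. Qed.

Section measurable_cV.
Context {d} {T : sigmaRingType d} (n : nat).

Let coors : 'I_n -> 'cV[T]_n -> T := fun i v => v i 0.

Let cV_set0 : g_sigma_preimage coors set0.
Proof. exact: sigma_algebra0. Qed.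

Let cV_setC A : g_sigma_preimage coors A -> g_sigma_preimage coors (~` A).
Proof. exact: sigma_algebraC. Qed.

Let cV_bigcup (F : (set 'cV[T]_n)^nat) :
  (forall i, g_sigma_preimage coors (F i)) ->
  g_sigma_preimage coors (\bigcup_i (F i)).
Proof. exact: sigma_algebra_bigcup. Qed.

HB.instance Definition _ := @isMeasurable.Build (measure_cV_display d)
  'cV[T]_n (g_sigma_preimage coors) cV_set0 cV_setC cV_bigcup.

End measurable_cV.

Lemma measurable_coord d (T : sigmaRingType d) n (i : 'I_n) :
  measurable_fun [set: 'cV[T]_n] (fun v => v i 0).
Proof.
move=> _ Y mY; rewrite setTI; apply: sub_sigma_algebra => /=.
rewrite -bigcup_seq/=; exists i => /=; first by rewrite mem_index_enum.
by exists Y => //; rewrite setTI.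
Qed.

Lemma measurable_fun_coordP d1 d2 (T1 : measurableType d1)
    (T2 : measurableType d2) n (f : T1 -> 'cV[T2]_n) :
  measurable_fun [set: T1] f <->
  forall i, measurable_fun [set: T1] (fun x => f x i 0).
Proof.
split=> [mf i|mf].
  exact: (measurableT_comp (@measurable_coord _ T2 n i) mf).
move=> _ A mA; rewrite setTI.
suff : g_sigma_preimage (fun i (v : 'cV[T2]_n) => v i 0)
    `<=` [set B | measurable (f @^-1` B)] by exact.
apply: smallest_sub.
  split=> /= [|B mB|F mF].
  - by rewrite preimage_set0.
  - by rewrite setTD preimage_setC; exact: measurableC.
  - by rewrite preimage_bigcup; exact: bigcupT_measurable.
move=> B; rewrite -bigcup_seq => -[i _] [C mC <-] /=.
by rewrite setTI; have := mf i measurableT _ mC; rewrite setTI.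
Qed.

Section lebesgue_step.
Context (R : realType) (n : nat).

Definition cV_cons (p : measurableTypeR R * 'cV[R]_n) : 'cV[R]_n.+1 :=
  col_mx (p.1 : R)%:M p.2.

Definition cV_uncons (v : 'cV[R]_n.+1) : measurableTypeR R * 'cV[R]_n :=
  (v ord0 0, \col_i v (lift ord0 i) 0).

Lemma cV_consK : cancel cV_cons cV_uncons.
Proof.
move=> [x v]; congr pair.
  by rewrite /cV_cons mxE split1 unlift_none /= mxE eqxx.
apply/matrixP => i j; rewrite !mxE split1 liftK /= (ord1 j).
by [].
Qed.

Lemma measurable_cV_cons : measurable_fun setT cV_cons.
Proof.
apply/measurable_fun_coordP => i; case: (unliftP ord0 i) => [j ->|->].
- apply: (eq_measurable_fun (fun p => (p.2 : 'cV[R]_n) j 0)).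
    by move=> p _; rewrite /cV_cons mxE split1 liftK.
  exact: (measurableT_comp (@measurable_coord _ R n j) measurable_snd).
- apply: (eq_measurable_fun fst); last exact: measurable_fst.
  by move=> p _; rewrite /cV_cons mxE split1 unlift_none /= mxE eqxx.
Qed.

Lemma measurable_cV_uncons : measurable_fun setT cV_uncons.
Proof.
apply: measurable_fun_pair; first exact: (@measurable_coord _ R n.+1 ord0).
apply/measurable_fun_coordP => i.
under eq_fun do rewrite mxE.
exact: (@measurable_coord _ R n.+1 (lift ord0 i)).
Qed.

Context (m : {sigma_finite_measure set 'cV[R]_n -> \bar R}).

(* The image of the product measure under the identification of R x R^n with
   R^(n+1). *)
Definition lebesgue_step : set 'cV[R]_n.+1 -> \bar R :=
  pushforward (@lebesgue_measure R \x m)%E cV_cons.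

Let preimage_cV_cons B :
  measurable B -> measurable (cV_cons @^-1` B).
Proof.
by move=> mB; rewrite -[X in measurable X]setTI; exact: measurable_cV_cons.
Qed.

Let lebesgue_step0 : lebesgue_step set0 = 0%E.
Proof. by rewrite /lebesgue_step /pushforward preimage_set0 measure0. Qed.

Let lebesgue_step_ge0 B : (0 <= lebesgue_step B)%E.
Proof. exact: (measure_ge0 (@lebesgue_measure R \x m)%E). Qed.

Let lebesgue_step_sigma_additive : semi_sigma_additive lebesgue_step.
Proof.
move=> F mF tF mUF; rewrite /lebesgue_step /pushforward preimage_bigcup.
apply: measure_semi_sigma_additive.
- by move=> k; exact: preimage_cV_cons.
- apply/trivIsetP => /= i j _ _ ij; rewrite -preimage_setI.
  by move/trivIsetP : tF => /(_ _ _ _ _ ij) ->//; rewrite preimage_set0.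
- by rewrite -preimage_bigcup; exact: preimage_cV_cons.
Qed.

HB.instance Definition _ := isMeasure.Build _ _ _ lebesgue_step
  lebesgue_step0 lebesgue_step_ge0 lebesgue_step_sigma_additive.

Let lebesgue_step_sigma_finite : sigma_finite setT lebesgue_step.
Proof.
have /sigma_finiteP[F [TF ndF Foo]] := sigma_finiteT (@lebesgue_measure R).
have /sigma_finiteP[G [TG ndG Goo]] := sigma_finiteT m.
exists (fun k => cV_uncons @^-1` (F k `*` G k)).
  rewrite -preimage_bigcup (_ : \bigcup_k _ = setT) ?preimage_setT//.
  rewrite -subTset => -[x y] _.
  have [i _ Fix] : (\bigcup_i F i) x by rewrite -TF.
  have [j _ Gjy] : (\bigcup_j G j) y by rewrite -TG.
  exists (maxn i j) => //; split.
  - by move: x Fix; exact/subsetPset/ndF/leq_maxl.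
  - by move: y Gjy; exact/subsetPset/ndG/leq_maxr.
move=> k; have [mF Fk] := Foo k; have [mG Gk] := Goo k; split.
  rewrite -[X in measurable X]setTI; apply: measurable_cV_uncons => //.
  exact: measurableX.
rewrite /lebesgue_step /pushforward -comp_preimage.
rewrite (_ : cV_uncons \o cV_cons = id).
  by rewrite preimage_id product_measure1E// lte_mul_pinfty// ge0_fin_numE.
by apply/funext => p /=; exact: cV_consK.
Qed.

HB.instance Definition _ := Measure_isSigmaFinite.Build _ _ _ lebesgue_step
  lebesgue_step_sigma_finite.

End lebesgue_step.

Section lebesgue_cV.
Context (R : realType).

(* Lebesgue measure on R^n; R^0 is a single point, of mass 1. *)
Fixpoint lebesgue_cV (n : nat) :
    {sigma_finite_measure set 'cV[R]_n -> \bar R} :=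
  if n is n'.+1 then lebesgue_step (lebesgue_cV n')
  else \d_(0 : 'cV[R]_0).

Definition enorm (d : nat) (v : 'cV[R]_d) : R :=
  Num.sqrt (\sum_(i < d) v i 0 ^+ 2).

Definition ediam (d : nat) (S : set 'cV[R]_d) : R :=
  sup [set enorm (x - y) | x in S & y in S].

Definition Gamma (s : R) : R :=
  (\int[lebesgue_measure]_(x in `]0, +oo[) (x `^ (s - 1) * expR (- x)))%R.

End lebesgue_cV.

Section lattice.
Context (R : realType) (d : nat) (A : 'M[R]_d).

Definition lattice : set 'cV[R]_d :=
  [set A *m map_mx intr z | z in [set: 'cV[int]_d]].

Definition fund_domain : set 'cV[R]_d :=
  [set A *m a | a in [set a : 'cV[R]_d | forall j, 0 <= a j 0 < 1]].

Definition covolume : R := `|\det A|.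

Lemma fund_domain_scale_ge0 :
  0 <= (fine (lebesgue_cV R d fund_domain))^-1.
Proof. by rewrite invr_ge0 fine_ge0. Qed.

(* Lebesgue measure rescaled to give the fundamental domain mass 1; it is only
   ever integrated against on the fundamental domain. *)
Definition mu_fund : {measure set 'cV[R]_d -> \bar R} :=
  mscale (NngNum fund_domain_scale_ge0) (lebesgue_cV R d).

(* The number of lattice translates of y in the closed ball of centre x and
   radius r. This set is finite when A is nonsingular; [fset_set] of an
   infinite set would be empty. *)
Definition ball_ind (x : 'cV[R]_d) (r : R) (y : 'cV[R]_d) : nat :=
  #|` fset_set [set v | lattice v /\ enorm (y + v - x) <= r] |.

(* It does not depend on the centre of the ball. *)
Definition ball_vol (r : R) : R :=
  covolume^-1 * (pi `^ (d%:R / 2) / Gamma (d%:R / 2 + 1)) * r ^+ d.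

(* At N = 0 this forces the empty set. *)
Definition point_sets (X : nat -> {fset 'cV[R]_d}) : Prop :=
  forall N, #|` X N| = N /\ (forall x, x \in X N -> fund_domain x).

Definition uniformly_distributed (X : nat -> {fset 'cV[R]_d}) : Prop :=
  forall (x : 'cV[R]_d) (r : R), 0 <= r <= ediam fund_domain / 2 ->
    (fun N => N%:R^-1 * \sum_(y <- X N) (ball_ind x r y)%:R) @ \oo
      --> ball_vol r.

Definition number_variance (Y : {fset 'cV[R]_d}) (r : R) : \bar R :=
  \int[mu_fund]_(x in fund_domain)
    ((\sum_(y <- Y) (ball_ind x r y)%:R - #|` Y|%:R * ball_vol r) ^+ 2)%:E.

(* The big-O bound includes the finiteness of the limsup for large t. *)
Definition hyperuniform_threshold (X : nat -> {fset 'cV[R]_d}) : Prop :=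
  exists C : R, \forall t \near +oo,
    (limn_esup (fun N => number_variance (X N) (t * N%:R `^ (- d%:R^-1)))
      <= (C * t ^+ d.-1)%:E)%E.

End lattice.

(* Main.v *)
(* Write rho = t N^(-1/d), let n(y) count the points of X_N in B(y, rho) and let
   V be the number variance at scale rho, so that n - N Vol(B(rho)) has
   L2-norm sqrt V <= const * t^((d-1)/2), while N Vol(B(rho)) is of order t^d.
   If h_s is the periodized indicator of B(x, s), the triangle inequality gives
     h_(r-rho)(y) 1_B(y,rho)(p) <= h_r(p) 1_B(y,rho)(p)
                                <= h_(r+rho)(y) 1_B(y,rho)(p).
   Summing over p in X_N and integrating over y bounds the empirical measure of
   B(x, r) between Vol(B(r - rho)) and Vol(B(r + rho)), up to an error
   of order t^(-1) coming from the variance. Let N tend to infinity, so that rho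
   tends to 0, and then t.

   The mean of h_s only enters as k s^d for some k > 0: the constant of
   [ball_vol] is never compared with the Lebesgue measure of the unit ball. *)
Require Import Defs.
From mathcomp Require Import all_boot all_order all_algebra finmap.
From mathcomp Require Import all_classical all_reals all_analysis.
From mathcomp Require Import measurable_realfun ring lra zify.

Set Implicit Arguments.
Unset Strict Implicit.
Unset Printing Implicit Defensive.

Import Order.TTheory GRing.Theory Num.Theory.
Import numFieldNormedType.Exports.

Local Open Scope classical_set_scope.
Local Open Scope ring_scope.

(** * Lebesgue measure on R^n under dilations and translations, and on cubes *)

Lemma scaled_pushforward d1 d2 (T1 : measurableType d1) (T2 : measurableType d2)
    (R : realType) (m : {measure set T1 -> \bar R}) (f : T1 -> T2) (k : R) :
  measurable_fun setT f -> 0 <= k ->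
  exists mu : {measure set T2 -> \bar R},
    forall B, mu B = (k%:E * m (f @^-1` B))%E.
Proof.
move=> mf k0.
(* The existential hides the structure built on the pushforward and exposes only its values, which
   is all that the uniqueness arguments below consult. *)
by exists (mscale (NngNum k0)
  (measure_function_pushforward__canonical__measure_function_Measure m mf)).
Qed.

Section affine.
Context (R : realType).
Implicit Types s c : R.

Lemma measurable_affine1 s c :
  measurable_fun setT (fun x : measurableTypeR R => s * x + c).
Proof.
by apply: measurable_funD => //; apply: measurable_funM.
Qed.

(** By uniqueness of Lebesgue measure: [s] times the pushforward along [x => s * x + c] gives every
    interval []a, b]] its length. *)
Lemma lebesgue_measure_affine s c (B : set (measurableTypeR R)) :
  0 < s -> measurable B ->
  lebesgue_measure ((fun x => s * x + c) @^-1` B) =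
  (s^-1%:E * lebesgue_measure B)%E.
Proof.
move=> s0 mB.
have [mu muE] := @scaled_pushforward _ _ (measurableTypeR R)
  (measurableTypeR R) _ (@lebesgue_measure R) _ s (measurable_affine1 s c)
  (ltW s0).
have : lebesgue_measure B = mu B.
  apply: lebesgue_measure_unique => // _ [[a b]] _ <-; rewrite muE /=.
  have -> : (fun x => s * x + c) @^-1` `]a, b] =
      `](a - c) / s, (b - c) / s]%classic.
    apply/seteqP; split => x /=; rewrite !in_itv /=.
      by rewrite ltr_pdivrMr// ler_pdivlMr// ltrBlDr lerBrDr mulrC.
    by rewrite ltr_pdivrMr// ler_pdivlMr// ltrBlDr lerBrDr mulrC.
  rewrite !lebesgue_measure_itv/= !lte_fin ltr_pM2r ?invr_gt0// ltrD2r.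
  case: ifP => _; rewrite ?mule0// -!EFinB -EFinM; congr EFin.
  by field; rewrite gt_eqF.
by rewrite muE => ->; rewrite muleA -EFinM mulVf ?mul1e// gt_eqF.
Qed.

Lemma measurable_affine n s (c : 'cV[R]_n) :
  measurable_fun setT (fun x : 'cV[R]_n => s *: x + c).
Proof.
apply/measurable_fun_coordP => i.
apply: (eq_measurable_fun (fun x : 'cV[R]_n => s * x i 0 + c i 0)).
  by move=> x _; rewrite !mxE.
apply: (measurableT_comp (@measurable_affine1 s (c i 0))).
exact: measurable_coord.
Qed.

(** Induction on [n]: the map acts separately on the first coordinate and on the others, so
    [s ^+ n.+1] times the pushforward agrees with the product measure on rectangles, hence
    everywhere. Below, [s = 1] gives translation invariance and [B] a ball gives the scaling of
    volumes. *)
Lemma lebesgue_cV_affine n s (c : 'cV[R]_n) (B : set 'cV[R]_n) :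
  0 < s -> measurable B ->
  lebesgue_cV R n ((fun x => s *: x + c) @^-1` B) =
  ((s ^- n)%:E * lebesgue_cV R n B)%E.
Proof.
move=> s0; elim: n c B => [|n IH] c B mB.
  rewrite expr0 invr1 mul1e; congr (lebesgue_cV R 0 _).
  by apply/seteqP; split => x /=; rewrite [_ + _](flatmx0 _) [x]flatmx0.
(* The factors cancel in the extended reals; this closes the check on rectangles below. *)
have mulE (l m : \bar R) :
    ((s ^+ n.+1)%:E * ((s^-1)%:E * l * ((s ^- n)%:E * m)) = l * m)%E.
  rewrite muleACA [LHS]muleA -!EFinM exprS -invfM mulfV ?mul1e//.
  by rewrite mulf_neq0 ?expf_neq0// gt_eqF.
pose c' : 'cV[R]_n := \col_i c (lift ord0 i) 0.
pose f (p : measurableTypeR R * 'cV[R]_n) : measurableTypeR R * 'cV[R]_n :=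
  (s * p.1 + c ord0 0, s *: p.2 + c').
have mf : measurable_fun setT f.
  apply: measurable_fun_pair.
    exact: (measurableT_comp (measurable_affine1 s (c ord0 0)) measurable_fst).
  exact: (measurableT_comp (measurable_affine s c') measurable_snd).
have [mu muE] := @scaled_pushforward _ _ _ _ _
  (@lebesgue_measure R \x lebesgue_cV R n)%E _ _ mf (exprn_ge0 n.+1 (ltW s0)).
rewrite /= /lebesgue_step /pushforward.
set B' := cV_cons (n:=n) @^-1` B.
have mB' : measurable B'.
  by rewrite /B' -[X in measurable X]setTI; exact: measurable_cV_cons.
have -> : cV_cons (n:=n) @^-1` ((fun x : 'cV[R]_n.+1 => s *: x + c) @^-1` B) =
    f @^-1` B'.
  rewrite /B'; apply/funext => p; rewrite /preimage /=; congr (B _).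
  apply/matrixP => i j; rewrite ord1 /cV_cons.
  case: (unliftP ord0 i) => [k ->|->].
    by rewrite !mxE split1 liftK /= !mxE.
  by rewrite !mxE split1 unlift_none /= !mxE eqxx !mulr1n.
have -> : ((lebesgue_measure \x lebesgue_cV R n) B' = mu B')%E.
  apply: product_measure_unique => // X Y mX mY; rewrite muE.
  have -> : f @^-1` (X `*` Y) = ((fun x => s * x + c ord0 0) @^-1` X) `*`
     ((fun x => s *: x + c') @^-1` Y) by [].
  rewrite [X in (_ * X)%E = _]product_measure1E//; last 2 first.
    rewrite -[X in measurable X]setTI; exact: measurable_affine1.
    rewrite -[X in measurable X]setTI; exact: measurable_affine.
  rewrite [X in (_ * (X * _))%E](@lebesgue_measure_affine s (c ord0 0) X)//.
  by rewrite [X in (_ * (_ * X))%E]IH.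
by rewrite muE muleA -EFinM mulVf ?mul1e// expf_neq0// gt_eqF.
Qed.

Lemma measurable_cube n (K : R) :
  measurable [set v : 'cV[R]_n | forall i, `|v i 0| <= K].
Proof.
rewrite (_ : [set v | _] =
    \bigcap_(i : 'I_n) ((fun v : 'cV[R]_n => v i 0) @^-1` `[- K, K])).
  apply: fin_bigcap_measurable => // i _.
  by rewrite -[X in measurable X]setTI; exact: measurable_coord.
apply/seteqP; split => v /= H i.
  by move=> _; rewrite /= in_itv/= -ler_norml.
by have := H i I; rewrite /= in_itv/= -ler_norml.
Qed.

Lemma lebesgue_cV_cube n (K : R) : 0 <= K ->
  lebesgue_cV R n [set v | forall i, `|v i 0| <= K] = ((K *+ 2) ^+ n)%:E.
Proof.
move=> K0; elim: n => [|n IH].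
  by rewrite /= diracE mem_set//= => -[].
rewrite /= /lebesgue_step /pushforward.
have -> : cV_cons (n:=n) @^-1` [set v | forall i, `|v i 0| <= K] =
    (`[- K, K]%classic : set (measurableTypeR R)) `*`
    [set v : 'cV[R]_n | forall i, `|v i 0| <= K].
  apply/seteqP; split => -[x v] /=.
    move=> H; split => [|i].
      have := H ord0; rewrite mxE split1 unlift_none /= mxE eqxx.
      by rewrite in_itv/= ler_norml.
    by have := H (lift ord0 i); rewrite mxE split1 liftK.
  rewrite in_itv/= -ler_norml => -[xK vK] i.
  by case: (unliftP ord0 i) => [k ->|->];
    rewrite mxE split1 ?liftK ?unlift_none //= mxE eqxx.
rewrite product_measure1E//; last exact: measurable_cube.
have H1 : lebesgue_measure (`[- K, K]%classic : set (measurableTypeR R)) =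
    (K *+ 2)%:E.
  rewrite lebesgue_measure_itv/= lte_fin; case: ifPn => [_|].
    by rewrite -EFinB opprK mulr2n.
  rewrite -leNgt => KN; have -> : K = 0; last by rewrite mul0rn.
  by apply/eqP; rewrite eq_le K0 andbT; move: KN; rewrite lerNr; lra.
by rewrite [X in (X * _)%E]H1 [X in (_ * X)%E]IH -EFinM exprS.
Qed.

End affine.

(** * The Euclidean norm and the volume of Euclidean balls *)

Section enorm.
Context (R : realType) (n : nat).
Implicit Types u v : 'cV[R]_n.

Lemma enorm_ge0 u : 0 <= enorm u.
Proof. exact: sqrtr_ge0. Qed.

Lemma sqr_enorm u : enorm u ^+ 2 = \sum_(i < n) u i 0 ^+ 2.
Proof. by rewrite sqr_sqrtr// sumr_ge0// => i _; exact: sqr_ge0. Qed.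

Lemma enormN u : enorm (- u) = enorm u.
Proof. by congr Num.sqrt; apply: eq_bigr => i _; rewrite mxE sqrrN. Qed.

Lemma enormZ (s : R) u : 0 <= s -> enorm (s *: u) = s * enorm u.
Proof.
move=> s0; rewrite /enorm.
under eq_bigr do rewrite mxE exprMn.
by rewrite -mulr_sumr sqrtrM ?sqr_ge0// sqrtr_sqr ger0_norm.
Qed.

Lemma norm_coord_le_enorm u i : `|u i 0| <= enorm u.
Proof.
rewrite -ler_sqr ?nnegrE ?enorm_ge0// sqr_enorm -normrX ger0_norm ?sqr_ge0//.
by rewrite (bigD1 i)//= lerDl sumr_ge0// => j _; exact: sqr_ge0.
Qed.

(* Lagrange's identity: the defect is half the sum of the squares of the
   2x2 minors of (u, v). *)
Lemma sum_coord_mul_le u v : \sum_(i < n) u i 0 * v i 0 <= enorm u * enorm v.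
Proof.
apply: le_trans (ler_norm _) _.
rewrite -ler_sqr ?nnegrE ?mulr_ge0 ?enorm_ge0// exprMn !sqr_enorm.
rewrite -normrX ger0_norm ?sqr_ge0//.
have : 0 <= \sum_(i < n) \sum_(j < n) (u i 0 * v j 0 - u j 0 * v i 0) ^+ 2.
  by apply: sumr_ge0 => i _; apply: sumr_ge0 => j _; exact: sqr_ge0.
have -> : \sum_(i < n) \sum_(j < n) (u i 0 * v j 0 - u j 0 * v i 0) ^+ 2 =
   \sum_(i < n) \sum_(j < n) (u i 0 ^+ 2 * v j 0 ^+ 2) +
   \sum_(i < n) \sum_(j < n) (u j 0 ^+ 2 * v i 0 ^+ 2) -
   (\sum_(i < n) \sum_(j < n) ((u i 0 * v i 0) * (u j 0 * v j 0))) *+ 2.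
  rewrite -sumrMnl -big_split/= -sumrB; apply: eq_bigr => i _.
  rewrite -sumrMnl -big_split/= -sumrB; apply: eq_bigr => j _.
  by ring.
rewrite [X in _ + X - _]exchange_big/= -!big_distrlr/= expr2 -mulr2n -mulrnBl.
by rewrite pmulrn_lge0// subr_ge0.
Qed.

Lemma enormD u v : enorm (u + v) <= enorm u + enorm v.
Proof.
rewrite -ler_sqr ?nnegrE ?addr_ge0 ?enorm_ge0// sqrrD !sqr_enorm.
under eq_bigr do rewrite mxE sqrrD.
rewrite !big_split/= lerD2r lerD2l mulr2n.
by apply: lerD; exact: sum_coord_mul_le.
Qed.

Lemma measurable_enorm : measurable_fun setT (@enorm R n).
Proof.
apply: (measurableT_comp (continuous_measurable_fun (@sqrt_continuous R))).
apply: measurable_sum => i; apply: measurable_funX.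
exact: measurable_coord.
Qed.

Lemma measurable_closed_ball (x : 'cV[R]_n) r :
  measurable [set v : 'cV[R]_n | enorm (v - x) <= r].
Proof.
rewrite (_ : [set v | _] = (fun v => 1 *: v + - x) @^-1`
    (@enorm R n @^-1` `]-oo, r])); last first.
  by apply/seteqP; split => v /=; rewrite in_itv/= scale1r.
rewrite -[X in measurable X]setTI; apply: measurable_affine => //.
by rewrite -[X in measurable X]setTI; exact: measurable_enorm.
Qed.

(* Only [0 < eball_vol1 n < +oo] matters below, not its value. *)
Definition eball_vol1 := fine (lebesgue_cV R n [set v | enorm v <= 1]).

(** The unit ball lies inside the cube of half-side [1] and contains the cube of half-side
    [1 / (n + 1)], so its volume is finite and positive. *)
Lemma lebesgue_cV_eball1 :
  lebesgue_cV R n [set v | enorm v <= 1] = eball_vol1%:E /\ 0 < eball_vol1.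
Proof.
have mB : measurable [set v : 'cV[R]_n | enorm v <= 1].
  by have := @measurable_closed_ball 0 1; under eq_set do rewrite subr0.
have mC K : measurable [set v : 'cV[R]_n | forall i, `|v i 0| <= K].
  exact: measurable_cube.
have fB : lebesgue_cV R n [set v | enorm v <= 1] \is a fin_num.
  rewrite ge0_fin_numE//.
  apply: (@le_lt_trans _ _ (lebesgue_cV R n [set v | forall i, `|v i 0| <= 1])).
    apply: le_measure; [exact: mem_set|exact: mem_set (mC _)|move=> v /= v1 i].
    exact: le_trans (norm_coord_le_enorm v i) v1.
  by rewrite lebesgue_cV_cube// ltry.
split; first by rewrite fineK.
rewrite fine_gt0//; apply/andP; split; last by rewrite -ge0_fin_numE.
(* Since [K <= 1], a coordinate bounded by [K] has square at most [K], and the [n] squares add up to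
   at most [n * K <= 1]. Taking [n + 1] covers [n = 0] as well. *)
pose K : R := n.+1%:R^-1.
have K0 : 0 < K by rewrite invr_gt0.
apply: (@lt_le_trans _ _ (lebesgue_cV R n [set v | forall i, `|v i 0| <= K])).
  by rewrite lebesgue_cV_cube ?(ltW K0)// lte_fin exprn_gt0// pmulrn_lgt0.
apply: le_measure; [exact: mem_set (mC _)|exact: mem_set|move=> v /= vK].
rewrite -(@ler_pXn2r _ 2)// ?nnegrE ?enorm_ge0// sqr_enorm expr1n.
apply: (@le_trans _ _ (\sum_(i < n) K)).
  apply: ler_sum => i _; rewrite -real_normK ?num_real// expr2.
  apply: le_trans (vK i); rewrite ler_piMl//.
  by apply: le_trans (vK i) _; rewrite invf_le1// ler1n.
rewrite sumr_const card_ord -[_ *+ n]mulr_natl ler_pdivrMr// mul1r.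
by rewrite ler_nat.
Qed.

Lemma lebesgue_cV_eball (x : 'cV[R]_n) r : 0 < r ->
  lebesgue_cV R n [set v | enorm (v - x) <= r] = (eball_vol1 * r ^+ n)%:E.
Proof.
move=> r0.
have := @lebesgue_cV_affine R n r x _ r0 (@measurable_closed_ball x r).
have -> : (fun v => r *: v + x) @^-1` [set v | enorm (v - x) <= r] =
    [set v | enorm v <= 1].
  apply/seteqP; split => v /=; rewrite addrK enormZ ?(ltW r0)//;
  by rewrite -{2}[r]mulr1 ler_pM2l.
rewrite (lebesgue_cV_eball1).1 => H.
rewrite mulrC EFinM H muleA -EFinM mulfV ?mul1e//.
by rewrite expf_neq0// gt_eqF.
Qed.

End enorm.

(** * Counting lattice translates in a ball *)

Lemma card_fset_set_le (T U : choiceType) (S : set T) (S' : set U)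
    (f : T -> U) :
  finite_set S' -> injective f -> (forall x, S x -> S' (f x)) ->
  (#|` fset_set S| <= #|` fset_set S'|)%N.
Proof.
move=> fS' injf SS'.
(* Both sets must be known to be finite, since [fset_set] sends an infinite set to the empty one. *)
have fS : finite_set S.
  apply: (@sub_finite_set _ _ (f @^-1` S')); first exact: SS'.
  by apply: finite_preimage => // x y _ _; exact: injf.
have <- : #|` (f @` fset_set S)%fset| = #|` fset_set S| by exact: card_imfset.
rewrite -fset_set_image//.
apply: fsubset_leq_card; rewrite -fset_set_sub//; last exact: finite_image.
by move=> _ [x Sx <-]; exact: SS'.
Qed.

Section lattice_counting.
Context (R : realType) (d : nat) (A : 'M[R]_d).
Hypothesis A_unit : A \in unitmx.
Implicit Types (x y p v w : 'cV[R]_d) (z : 'cV[int]_d) (r rho : R).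

Definition latpt (z : 'cV[int]_d) : 'cV[R]_d := A *m map_mx intr z.

Lemma latpt_inj : injective latpt.
Proof.
move=> z1 z2 /(congr1 (mulmx (invmx A))); rewrite !mulKmx// => /matrixP E.
by apply/matrixP => i j; have := E i j; rewrite !mxE => /intr_inj.
Qed.

Lemma latticeN v : lattice A v -> lattice A (- v).
Proof.
by move=> [z _ <-]; exists (- z) => //; rewrite -mulmxN map_mxN.
Qed.

Lemma latticeB v w : lattice A v -> lattice A w -> lattice A (v - w).
Proof.
move=> [z _ <-] [z' _ <-]; exists (z - z') => //.
by rewrite -mulmxBr map_mxB.
Qed.

Lemma fund_domainP y :
  fund_domain A y <-> forall j, 0 <= (invmx A *m y) j 0 < 1.
Proof.
split=> [[a a01 <-]|H]; first by rewrite mulKmx.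
by exists (invmx A *m y) => //; rewrite mulKVmx.
Qed.

Lemma invmx_mul_latptB y z j :
  (invmx A *m (y - latpt z)) j 0 = (invmx A *m y) j 0 - (z j 0)%:~R.
Proof. by rewrite mulmxBr mulKmx// !mxE. Qed.

Lemma fund_domain_cover y : exists z, fund_domain A (y - latpt z).
Proof.
exists (\col_j Num.floor ((invmx A *m y) j 0)); apply/fund_domainP => j.
rewrite invmx_mul_latptB mxE subr_ge0 floor_le/= ltrBlDl.
by rewrite -[1]/(1%:~R) -intrD floorD1_gt.
Qed.

(** The coordinates of [z] are forced to be the integer parts of those of [invmx A *m y]. *)
Lemma fund_domain_disjoint y z z' :
  fund_domain A (y - latpt z) -> fund_domain A (y - latpt z') -> z = z'.
Proof.
move=> /fund_domainP H /fund_domainP H'; apply/matrixP => j k; rewrite ord1.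
have floorE u : (forall j, 0 <= (invmx A *m (y - latpt u)) j 0 < 1) ->
    Num.floor ((invmx A *m y) j 0) = u j 0.
  move=> /(_ j); rewrite invmx_mul_latptB subr_ge0 ltrBlDl => /andP[h1 h2].
  by apply: floor_def; rewrite h1 intrD.
by rewrite -(floorE z)// -(floorE z').
Qed.

Lemma mulmx_coord_bound (B : 'M[R]_d) (v : 'cV[R]_d) (b : R) i :
  (forall j, `|v j 0| <= b) ->
  `|(B *m v) i 0| <= (\sum_i \sum_j `|B i j|) * b.
Proof.
move=> vb; rewrite mxE; apply: le_trans (ler_norm_sum _ _ _) _.
apply: (@le_trans _ _ ((\sum_j `|B i j|) * b)).
  rewrite mulr_suml; apply: ler_sum => j _.
  by rewrite normrM ler_wpM2l.
have [j|n0] := pickP 'I_d; last first.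
  by rewrite !big1// => j; have := n0 j.
move=> _; apply: ler_wpM2r; first exact: le_trans (vb j).
rewrite [leRHS](bigD1 i)//= lerDl.
by apply: sumr_ge0 => k _; apply: sumr_ge0.
Qed.

Lemma fund_domain_bounded :
  exists Y : R, forall y, fund_domain A y -> forall j, `|y j 0| <= Y.
Proof.
exists ((\sum_i \sum_j `|A i j|) * 1) => _ [a a01 <-] j.
apply: mulmx_coord_bound => k; have /andP[h1 h2] := a01 k.
by rewrite ger0_norm// ltW.
Qed.

(** Recover [z] from [latpt z] by applying [invmx A]. The bound [K] is uniform over bounded [y], so
    one finite box of integer vectors serves all of them. *)
Lemma lattice_coord_bound (Y : R) x r : exists K : nat, forall y z,
  (forall j, `|y j 0| <= Y) -> enorm (y + latpt z - x) <= r ->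
  forall i, `|z i 0| <= K%:Z.
Proof.
(* A bound on the coordinates of [latpt z], written as [(y + latpt z - x) + x - y]: one summand for
   each of the three terms. *)
pose b := r + \sum_i `|x i 0| + Y.
exists (Num.truncn ((\sum_i \sum_j `|invmx A i j|) * b)).+1 => y z yY zr i.
rewrite -(ler_int R) intr_norm.
apply: le_trans (ltW (truncnS_gt _)).
rewrite (_ : (z i 0)%:~R = (invmx A *m latpt z) i 0); last first.
  by rewrite mulKmx// mxE.
apply: mulmx_coord_bound => j.
rewrite (_ : latpt z = (y + latpt z - x) + x - y); last first.
  by apply/matrixP => ? ?; rewrite !mxE; ring.
rewrite !mxE; apply: le_trans (ler_normB _ _) _; apply: lerD => //.
apply: le_trans (ler_normD _ _) _; apply: lerD.
  have := norm_coord_le_enorm (y + latpt z - x) j; rewrite !mxE => H.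
  exact: le_trans H zr.
by rewrite [leRHS](bigD1 j)//= lerDl sumr_ge0.
Qed.

(** Parametrizes the integer vectors with coordinates in [[-K, K]] by a finite type, so that lattice
    sums become big operators over an index type independent of [y]. *)
Definition box_vec (K : nat) (a : 'cV['I_K.*2.+1]_d) : 'cV[int]_d :=
  map_mx (fun i : 'I_K.*2.+1 => (i : nat)%:Z - K%:Z) a.

Lemma box_vec_inj K : injective (@box_vec K).
Proof.
move=> a b /matrixP E; apply/matrixP => i j; have := E i j; rewrite !mxE.
by move=> /addIr [] /ord_inj.
Qed.

Lemma box_vec_surj K z : (forall i, `|z i 0| <= K%:Z) ->
  exists a, @box_vec K a = z.
Proof.
move=> zK; exists (\col_i inord (absz (z i 0 + K%:Z)) :> 'cV['I_K.*2.+1]_d).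
apply/matrixP => i j; rewrite ord1 !mxE; have := zK i.
rewrite ler_norml => /andP[h1 h2].
rewrite inordK; first by rewrite gez0_abs ?addrK//; lia.
lia.
Qed.

Lemma ball_set_bij (Y : R) x r : exists K : nat, forall y,
  (forall j, `|y j 0| <= Y) ->
  [set v | lattice A v /\ enorm (y + v - x) <= r] =
  (latpt \o @box_vec K) @` [set a | enorm (y + latpt (@box_vec K a) - x) <= r].
Proof.
have [K HK] := lattice_coord_bound Y x r; exists K => y yY.
apply/seteqP; split => [v [[z _ <-]] zr|_ [a ar <-]]; last first.
  by split => //; exists (box_vec a).
have [a az] := box_vec_surj (HK _ _ yY zr).
by exists a; rewrite /= az.
Qed.

Lemma finite_ball_set x r y :
  finite_set [set v | lattice A v /\ enorm (y + v - x) <= r].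
Proof.
have [K ->] := ball_set_bij (\sum_j `|y j 0|) x r.
  exact/finite_image/finite_finset.
by move=> j; rewrite [leRHS](bigD1 j)//= lerDl sumr_ge0.
Qed.

(** For bounded [y] the count is a sum of finitely many 0-1 terms. The second conclusion, that no
    lattice vector outside the box contributes, is kept for the tiling of the ball. *)
Lemma ball_ind_sum (Y : R) x r : exists K : nat, forall y,
  (forall j, `|y j 0| <= Y) ->
  ball_ind A x r y = (\sum_(a : 'cV['I_K.*2.+1]_d)
    (enorm (y + latpt (@box_vec K a) - x) <= r)%R : nat)%N /\
  forall z, enorm (y + latpt z - x) <= r -> exists a, @box_vec K a = z.
Proof.
have [K HK] := ball_set_bij Y x r; exists K => y /HK E; split; last first.
  move=> z zr; have : [set v | lattice A v /\ enorm (y + v - x) <= r] (latpt z).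
    by split => //; exists z.
  by rewrite E => -[a _ /latpt_inj <-]; exists a.
rewrite /ball_ind E fset_set_image//; last exact: finite_finset.
rewrite (card_imfset _ _ (inj_comp latpt_inj (@box_vec_inj K)))/=.
rewrite -/(#|` _|) card_fset_sum1 big_uniq ?fset_uniq//= big_mkcond/=.
apply: eq_bigr => a _; rewrite in_fset_set; last exact: finite_finset.
case: ifPn => [/set_mem /= -> //|].
by rewrite notin_setE /= => /negP/negbTE ->.
Qed.

(** The map [v => v - w] injects one set of translates into the other, by the triangle
    inequality. *)
Lemma ball_ind_le_shift x r rho p y w :
  lattice A w -> enorm (p + w - y) <= rho ->
  (ball_ind A x r p <= ball_ind A x (r + rho) y)%N.
Proof.
move=> Lw pwy; apply: (@card_fset_set_le _ _ _ _ (fun v => v - w)).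
- exact: finite_ball_set.
- exact: addIr.
- move=> v [Lv vr]; split; first exact: latticeB.
  rewrite (_ : y + (v - w) - x = (p + v - x) + - (p + w - y)); last first.
    by apply/matrixP => ? ?; rewrite !mxE; ring.
  by apply: le_trans (enormD _ _) _; rewrite enormN lerD.
Qed.

Lemma ball_ind_le x r r' y : r <= r' ->
  (ball_ind A x r y <= ball_ind A x r' y)%N.
Proof.
move=> rr'; apply: (@card_fset_set_le _ _ _ _ id) => //.
  exact: finite_ball_set.
by move=> v [Lv vr]; split => //; exact: le_trans rr'.
Qed.

(** The map [v => - v] exchanges the two sets of translates. *)
Lemma ball_indC x r y : ball_ind A x r y = ball_ind A y r x.
Proof.
wlog suff H : x y / (ball_ind A x r y <= ball_ind A y r x)%N.
  by apply/eqP; rewrite eqn_leq !H.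
apply: (@card_fset_set_le _ _ _ _ -%R).
- exact: finite_ball_set.
- exact: oppr_inj.
- move=> v [Lv vr]; split; first exact: latticeN.
  rewrite (_ : x - v - y = - (y + v - x)) ?enormN//.
  by apply/matrixP => ? ?; rewrite !mxE; ring.
Qed.

Lemma ball_ind_gt0 x r y : (0 < ball_ind A x r y)%N ->
  exists2 w, lattice A w & enorm (y + w - x) <= r.
Proof.
rewrite cardfs_gt0 => /fset0Pn[w]; rewrite in_fset_set; last first.
  exact: finite_ball_set.
by rewrite inE => -[]; exists w.
Qed.

(** The common factor is either zero or provides a lattice vector [w] bringing [p] within [rho] of
    [y], to which the shift inequality applies. Keeping the factor turns this local comparison into
    one valid for all [p] and [y]. *)
Lemma ball_ind_mul_le_shift x r rho p y :
  (ball_ind A x r p * ball_ind A y rho p <=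
   ball_ind A x (r + rho) y * ball_ind A y rho p)%N.
Proof.
have [->|] := posnP (ball_ind A y rho p); first by rewrite !muln0.
move=> /ball_ind_gt0[w Lw pw]; rewrite leq_mul2r (ball_ind_le_shift _ _ Lw)//.
exact: orbT.
Qed.

Lemma ball_ind_shift_le_mul x r rho p y :
  (ball_ind A x (r - rho) y * ball_ind A y rho p <=
   ball_ind A x r p * ball_ind A y rho p)%N.
Proof.
have [->|] := posnP (ball_ind A y rho p); first by rewrite !muln0.
move=> /ball_ind_gt0[w Lw pw]; rewrite leq_mul2r; apply/orP; right.
rewrite -[X in (_ <= ball_ind A x X p)%N](subrK rho r).
(* The roles of [p] and [y] are exchanged, so the lattice vector changes sign. *)
apply: (ball_ind_le_shift _ _ (latticeN Lw)).
rewrite (_ : y - w - p = - (p + w - y)) ?enormN//.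
by apply/matrixP => ? ?; rewrite !mxE; ring.
Qed.

End lattice_counting.

(** * Integrating the periodized ball indicator over the fundamental domain *)

Section torus_integral.
Context (R : realType) (d : nat) (A : 'M[R]_d).
Hypothesis A_unit : A \in unitmx.
Implicit Types (x y p : 'cV[R]_d) (r : R).
Local Notation Omega := (fund_domain A).
Local Notation leb := (lebesgue_cV R d).

Lemma measurable_fund_domain : measurable (fund_domain A).
Proof.
rewrite (_ : fund_domain A = \bigcap_(j : 'I_d)
    ((fun y => (invmx A *m y) j 0) @^-1` `[0, 1[%classic)); last first.
  apply/seteqP; split => y.
    by move=> /(fund_domainP A_unit) H j _; rewrite /= in_itv/=.
  move=> H; apply/(fund_domainP A_unit) => j.
  by have := H j I; rewrite /= in_itv/=.
apply: fin_bigcap_measurable => // j _.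
rewrite -[X in measurable X]setTI.
have : measurable_fun setT (fun y => (invmx A *m y) j 0); last exact.
apply: (eq_measurable_fun (fun y => \sum_k invmx A j k * y k 0)).
  by move=> y _; rewrite mxE.
apply: measurable_sum => k; apply: measurable_funM => //.
exact: measurable_coord.
Qed.

Lemma ball_ind_bounded x r : exists M : nat, forall y,
  Omega y -> (ball_ind A x r y <= M)%N.
Proof.
have [Y OY] := fund_domain_bounded A.
have [K HK] := ball_ind_sum A_unit Y x r.
exists #|'cV['I_K.*2.+1]_d| => y /OY /HK[-> _].
by rewrite -sum1_card; apply: leq_sum => a _; exact: leq_b1.
Qed.

Let ball_at (K : nat) x r (a : 'cV['I_K.*2.+1]_d) : set 'cV[R]_d :=
  [set y | enorm (y - (x - latpt A (box_vec a))) <= r].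

Let measurable_ball_at K x r a : measurable (@ball_at K x r a).
Proof. exact: measurable_closed_ball. Qed.

Lemma ball_ind_indic x r : exists K, forall y, Omega y ->
  (ball_ind A x r y)%:R = \sum_a \1_(@ball_at K x r a) y :> R /\
  forall z, enorm (y + latpt A z - x) <= r -> exists a, @box_vec d K a = z.
Proof.
have [Y OY] := fund_domain_bounded A.
have [K HK] := ball_ind_sum A_unit Y x r; exists K => y /OY /HK[-> HS].
split=> //; rewrite natr_sum; apply: eq_bigr => a _; rewrite indicE.
congr (nat_of_bool _)%:R; rewrite /ball_at.
apply/idP/idP => [H|/set_mem]; last by rewrite /= opprB addrA.
by apply/mem_set; rewrite /= opprB addrA.
Qed.

Lemma measurable_ball_ind x r :
  measurable_fun Omega (fun y => (ball_ind A x r y)%:R : R).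
Proof.
have [K HK] := ball_ind_indic x r.
apply: (eq_measurable_fun (fun y => \sum_a \1_(@ball_at K x r a) y : R)).
  by move=> y /set_mem /HK[].
apply: measurable_sum => a; apply: measurable_funS measurableT _ _ => //.
exact: measurable_indic.
Qed.

(* Translating each piece Omega `&` (B(x, r) - v) by v, v in the lattice, tiles
   the ball. *)
Lemma integral_ball_ind x r : 0 < r ->
  (\int[leb]_(y in Omega) (ball_ind A x r y)%:R%:E =
   (eball_vol1 R d * r ^+ d)%:E)%E.
Proof.
move=> r0; have [K HK] := ball_ind_indic x r.
pose G (a : 'cV['I_K.*2.+1]_d) : set 'cV[R]_d :=
  [set u | Omega (u - latpt A (box_vec a)) /\ enorm (u - x) <= r].
have GE a : G a = [set u | Omega (1 *: u + - latpt A (box_vec a))] `&`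
    [set u | enorm (u - x) <= r].
  by apply/seteqP; split => u; rewrite /G /= scale1r.
have mG a : measurable (G a).
  rewrite GE; apply: measurableI; last exact: measurable_closed_ball.
  rewrite -[X in measurable X]setTI.
  by apply: measurable_affine => //; exact: measurable_fund_domain.
have leb_ballE : leb [set u | enorm (u - x) <= r] = (\sum_a leb (G a))%E.
  rewrite fsbig_seq ?index_enum_uniq// -measure_fin_bigcup//; last first.
    apply/trivIsetP => a b _ _ ab; apply/eqP/negPn/negP => /set0P[u].
    move=> [[Oa _] [Ob _]]; move/eqP : ab; apply; apply: (@box_vec_inj d K).
    exact: fund_domain_disjoint Oa Ob.
  congr (leb _); apply/seteqP; split => [u ux|u [a _] []//].
  (* Some translate of the fundamental domain contains [u]; since [u] lies in the ball, the second
     conclusion of [ball_ind_indic] puts [z] in the box. *)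
  have [z zO] := fund_domain_cover A_unit u.
  have [_ /(_ z)[]] := HK _ zO; first by rewrite subrK.
  by move=> a az; exists a; rewrite /= ?mem_index_enum// /G /= az.
rewrite -(lebesgue_cV_eball x r0) leb_ballE.
transitivity (\int[leb]_(y in Omega)
    (\sum_a (\1_(@ball_at K x r a) y)%:E))%E.
  by apply: eq_integral => y /set_mem yO; rewrite (HK y yO).1 sumEFin.
rewrite ge0_integral_sum//; first last.
- move=> a; apply/measurable_EFinP.
  by apply: measurable_funS measurableT _ _ => //; exact: measurable_indic.
- exact: measurable_fund_domain.
apply: eq_bigr => a _; rewrite integral_indic//; last first.
  exact: measurable_fund_domain.
have := @lebesgue_cV_affine R d 1 (latpt A (box_vec a)) _ ltr01 (mG a).
rewrite expr1n invr1 mul1e => <-; congr (leb _).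
apply/seteqP; split => y; rewrite /= /G /ball_at /= scale1r addrK opprB addrA;
  by case.
Qed.

(** Finite because the domain is bounded. Positive because over a null domain the bounded function
    [ball_ind A 0 1] would integrate to zero, against [integral_ball_ind]. *)
Lemma lebesgue_cV_fund_domain :
  exists2 V : R, 0 < V & leb Omega = V%:E.
Proof.
have [Y OY] := fund_domain_bounded A.
have [M HM] := ball_ind_bounded 0 1.
have mO := measurable_fund_domain.
have leby : (leb Omega < +oo)%E.
  apply: (@le_lt_trans _ _
      (leb [set v | forall i, `|v i 0| <= `|Y|])); last first.
    by rewrite lebesgue_cV_cube// ltry.
  apply: le_measure; [exact: mem_set|exact: mem_set (measurable_cube _)|].
  by move=> v /OY vY i; exact: le_trans (vY i) (ler_norm Y).
have fleb : leb Omega \is a fin_num by rewrite ge0_fin_numE.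
exists (fine (leb Omega)); last by rewrite fineK.
rewrite fine_gt0// leby andbT lt0e measure_ge0 andbT; apply/eqP => O0.
have : (\int[leb]_(y in Omega) (ball_ind A 0 1 y)%:R%:E <= 0)%E.
  have <- : (\int[leb]_(y in Omega) (cst M%:R%:E) y)%E = 0%E.
    by rewrite integral_cst// [X in (_ * X)%E]O0 mule0.
  apply: ge0_le_integral => //.
  - by apply/measurable_EFinP; exact: measurable_ball_ind.
  - by move=> y /HM yM; rewrite lee_fin ler_nat.
rewrite integral_ball_ind// expr1n mulr1 lee_fin leNgt.
by rewrite (lebesgue_cV_eball1 R d).2.
Qed.

Lemma mu_fund_domain : mu_fund A Omega = 1%E.
Proof.
have [V V0 lebV] := lebesgue_cV_fund_domain.
rewrite /mu_fund /= /mscale /= lebV /= -EFinM mulVf// gt_eqF//.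
Qed.

(** The constant is the volume of the unit ball over that of the fundamental domain; what matters is
    that one [k] serves all centres and radii. *)
Lemma integral_mu_ball_ind : exists2 k : R, 0 < k & forall x r, 0 < r ->
  (\int[mu_fund A]_(y in Omega) (ball_ind A x r y)%:R%:E = (k * r ^+ d)%:E)%E.
Proof.
have [V V0 lebV] := lebesgue_cV_fund_domain.
exists (V^-1 * eball_vol1 R d).
  by rewrite mulr_gt0 ?invr_gt0// (lebesgue_cV_eball1 R d).2.
move=> x r r0; rewrite ge0_integral_mscale//.
- by rewrite integral_ball_ind//= lebV /= -EFinM mulrA.
- exact: measurable_fund_domain.
- by apply/measurable_EFinP; exact: measurable_ball_ind.
Qed.

End torus_integral.

(** * From the number variance to two-sided bounds on ball counts *)

Lemma limn_esup_lt_near (R : realType) (u : nat -> \bar R) l :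
  (limn_esup u < l)%E -> \forall n \near \oo, (u n <= l)%E.
Proof.
(* The upper limit is an infimum of suprema over neighbourhoods of infinity, so a strict inequality
   is already witnessed by one neighbourhood [V]. *)
move=> /ereal_inf_lt[_ [V oV <-]] /ltW supl.
apply: filterS oV => n Vn; apply: le_trans supl.
by apply: ereal_sup_ubound; exists n.
Qed.

(* AM-GM in the form [2 f <= a + f^2 / a]. *)
Lemma mul_le_amgm (R : realFieldType) (h M a f : R) : 0 <= h <= M -> 0 < a ->
  h * `|f| <= M / 2 * (a + a^-1 * f ^+ 2).
Proof.
move=> /andP[h0 hM] a0; apply: (@le_trans _ _ (M * `|f|)).
  by rewrite ler_wpM2r.
rewrite -mulrA ler_wpM2l ?(le_trans h0)//.
have -> : f ^+ 2 = `|f| ^+ 2 by rewrite -normrX ger0_norm ?sqr_ge0.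
rewrite -subr_ge0; set g := `|f|.
have -> : 2^-1 * (a + a^-1 * g ^+ 2) - g = (2 * a)^-1 * (g - a) ^+ 2.
  by field; rewrite gt_eqF.
by rewrite mulr_ge0 ?sqr_ge0// invr_ge0 mulr_ge0// ltW.
Qed.

Section variance.
Context (R : realType) (d : nat) (A : 'M[R]_d).
Hypothesis A_unit : A \in unitmx.
Implicit Types (x y p : 'cV[R]_d) (r : R) (Y : {fset 'cV[R]_d}).
Local Notation Omega := (fund_domain A).
Local Notation mu := (mu_fund A).

(** The quantity whose square [number_variance] integrates, as a function of the centre [y]. *)
Definition deviation Y r y : R :=
  \sum_(p <- Y) (ball_ind A y r p)%:R - #|` Y|%:R * ball_vol A r.

Let measurable_ball_ind_center p r :
  measurable_fun Omega (fun y => (ball_ind A y r p)%:R : R).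
Proof.
apply: (eq_measurable_fun (fun y => (ball_ind A p r y)%:R : R)).
  by move=> y _; rewrite ball_indC.
exact: measurable_ball_ind.
Qed.

Let measurable_deviation Y r : measurable_fun Omega (deviation Y r).
Proof.
apply: measurable_funB => //; apply: measurable_sum => p.
exact: measurable_ball_ind_center.
Qed.

(** Integrates the pointwise bound: the domain has mass 1, so the constant [m * a] is its own
    integral, and the squared deviation integrates to the variance, at most [v]. *)
Lemma le_integral_variance Y r (m a v I1 I2 : R) (f1 f2 : 'cV[R]_d -> R) :
  0 <= m -> 0 < a -> (number_variance A Y r <= v%:E)%E ->
  measurable_fun Omega f1 -> measurable_fun Omega f2 ->
  (forall y, Omega y -> 0 <= f1 y) -> (forall y, Omega y -> 0 <= f2 y) ->
  (\int[mu]_(y in Omega) (f1 y)%:E = I1%:E)%E ->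
  (\int[mu]_(y in Omega) (f2 y)%:E = I2%:E)%E ->
  (forall y, Omega y ->
    f1 y <= f2 y + m * (a + a^-1 * deviation Y r y ^+ 2)) ->
  I1 <= I2 + m * (a + a^-1 * v).
Proof.
move=> m0 a0 varv mf1 mf2 f10 f20 int1 int2 f12.
have mO := measurable_fund_domain A_unit.
have mD := measurable_deviation Y r.
have ma0 : (0 <= (m * a)%:E)%E by rewrite lee_fin mulr_ge0// ltW.
have ma'0 : (0 <= (m / a)%:E)%E.
  by rewrite lee_fin mulr_ge0// invr_ge0 ltW.
rewrite -lee_fin -int1.
apply: (@le_trans _ _ (\int[mu]_(y in Omega)
    ((f2 y)%:E + ((m * a)%:E + (m / a)%:E * (deviation Y r y ^+ 2)%:E)))%E).
  apply: ge0_le_integral => //.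
  - exact/measurable_EFinP.
  - apply: emeasurable_funD; first exact/measurable_EFinP.
    apply: emeasurable_funD => //; apply: emeasurable_funM => //.
    by apply/measurable_EFinP; exact: measurable_funX.
  - move=> y yO; rewrite -EFinM -!EFinD lee_fin.
    by apply: le_trans (f12 _ yO) _; rewrite mulrDr mulrA.
have mD2 : measurable_fun Omega (fun y => (deviation Y r y ^+ 2)%:E).
  by apply/measurable_EFinP; exact: measurable_funX.
have D20 y : (0 <= (deviation Y r y ^+ 2)%:E)%E by rewrite lee_fin sqr_ge0.
rewrite ge0_integralD//; first last.
- by apply: emeasurable_funD => //; exact: emeasurable_funM.
- by move=> y _; apply: adde_ge0 => //; exact: mule_ge0.
- exact/measurable_EFinP.
rewrite ge0_integralD//; first last.
- exact: emeasurable_funM.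
- by move=> y _; rewrite mule_ge0.
rewrite int2 integral_cst// mu_fund_domain// mule1 ge0_integralZl//.
rewrite mulrDr mulrA !EFinD leeD2l// leeD2l// [leRHS]EFinM.
exact: lee_wpmul2l.
Qed.

(** By the symmetry [ball_indC], each term is [w p] times the mean of the ball indicator centred at
    [p]. *)
Lemma integral_sum_ball_ind (k : R) Y (w : 'cV[R]_d -> nat) r :
  (forall x, (\int[mu]_(y in Omega) (ball_ind A x r y)%:R%:E =
     (k * r ^+ d)%:E)%E) ->
  (\int[mu]_(y in Omega) (\sum_(p <- Y) (w p * ball_ind A y r p)%:R)%:E =
    ((\sum_(p <- Y) (w p)%:R) * (k * r ^+ d))%:E)%E.
Proof.
move=> intk; under eq_integral do rewrite -sumEFin.
rewrite ge0_integral_sum//; first last.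
- move=> p; apply/measurable_EFinP; under eq_fun do rewrite natrM.
  by apply: measurable_funM => //; exact: measurable_ball_ind_center.
- exact: measurable_fund_domain.
rewrite mulr_suml -sumEFin; apply: eq_bigr => p _; rewrite EFinM -(intk p).
rewrite -ge0_integralZl//.
- by apply: eq_integral => y _; rewrite natrM EFinM ball_indC.
- exact: measurable_fund_domain.
- by apply/measurable_EFinP; exact: measurable_ball_ind.
Qed.

Lemma ball_vol_ge0 r : 0 <= r -> 0 <= ball_vol A r.
Proof.
move=> r0; rewrite /ball_vol /covolume mulr_ge0 ?exprn_ge0//.
rewrite mulr_ge0 ?invr_ge0//.
rewrite divr_ge0 ?powR_ge0//; apply: Rintegral_ge0 => x _.
by rewrite mulr_ge0 ?powR_ge0 ?expR_ge0.
Qed.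

(** Sum the shift inequality over [p], split the count around [y] into its mean plus [deviation],
    and absorb the product of the deviation with [ball_ind A x (r + rho) y <= M] by AM-GM; then
    integrate over [y]. *)
Lemma sum_ball_ind_upper (k : R) Y x r rho (M : nat) (a v : R) :
  (forall x r, 0 < r ->
    (\int[mu]_(y in Omega) (ball_ind A x r y)%:R%:E = (k * r ^+ d)%:E)%E) ->
  0 <= r -> 0 < rho ->
  (forall y, Omega y -> (ball_ind A x (r + rho) y <= M)%N) ->
  0 < a -> (number_variance A Y rho <= v%:E)%E ->
  (\sum_(p <- Y) (ball_ind A x r p)%:R) * (k * rho ^+ d) <=
  #|` Y|%:R * ball_vol A rho * (k * (r + rho) ^+ d) +
    M%:R / 2 * (a + a^-1 * v).
Proof.
move=> intk r0 rho0 HM a0 varv.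
have vol0 : 0 <= #|` Y|%:R * ball_vol A rho.
  by rewrite mulr_ge0// ball_vol_ge0// ltW.
apply: (@le_integral_variance Y rho (M%:R / 2) a v _ _
  (fun y => \sum_(p <- Y) (ball_ind A x r p * ball_ind A y rho p)%:R)
  (fun y => #|` Y|%:R * ball_vol A rho * (ball_ind A x (r + rho) y)%:R)) => //.
- apply: measurable_sum => p; under eq_fun do rewrite natrM.
  by apply: measurable_funM => //; exact: measurable_ball_ind_center.
- by apply: measurable_funM => //; exact: measurable_ball_ind.
- by move=> y _; apply: sumr_ge0.
- by move=> y _; rewrite mulr_ge0.
- by apply: integral_sum_ball_ind => z; exact: intk.
- under eq_integral do rewrite EFinM.
  rewrite ge0_integralZl//; first by rewrite intk// ltr_wpDl.
  + exact: measurable_fund_domain.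
  + by apply/measurable_EFinP; exact: measurable_ball_ind.
- move=> y yO.
  have le1 : \sum_(p <- Y) (ball_ind A x r p * ball_ind A y rho p)%:R <=
      (ball_ind A x (r + rho) y)%:R *
        \sum_(p <- Y) (ball_ind A y rho p)%:R :> R.
    rewrite mulr_sumr; apply: ler_sum => p _.
    by rewrite -natrM ler_nat ball_ind_mul_le_shift.
  apply: le_trans le1 _.
  have le2 := @mul_le_amgm R (ball_ind A x (r + rho) y)%:R M%:R a
    (deviation Y rho y).
  (* This splits the number of points in the ball around [y] into deviation plus expected number. *)
  rewrite -[X in _ * X <= _](subrK (#|` Y|%:R * ball_vol A rho)).
  rewrite -/(deviation Y rho y) mulrDr [leRHS]addrC.
  rewrite [_ * (_ * ball_vol _ _)]mulrC lerD2r; apply: le_trans (le2 _ a0); last by rewrite ler0n ler_nat HM.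
  by rewrite ler_wpM2l// ler_norm.
Qed.

(** The mirror argument with the inner radius [r - rho]; [rho < r] keeps that radius positive, as
    [intk] demands. *)
Lemma sum_ball_ind_lower (k : R) Y x r rho (M : nat) (a v : R) :
  (forall x r, 0 < r ->
    (\int[mu]_(y in Omega) (ball_ind A x r y)%:R%:E = (k * r ^+ d)%:E)%E) ->
  0 < rho -> rho < r ->
  (forall y, Omega y -> (ball_ind A x (r - rho) y <= M)%N) ->
  0 < a -> (number_variance A Y rho <= v%:E)%E ->
  #|` Y|%:R * ball_vol A rho * (k * (r - rho) ^+ d) <=
  (\sum_(p <- Y) (ball_ind A x r p)%:R) * (k * rho ^+ d) +
    M%:R / 2 * (a + a^-1 * v).
Proof.
move=> intk rho0 rhor HM a0 varv.
have vol0 : 0 <= #|` Y|%:R * ball_vol A rho.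
  by rewrite mulr_ge0// ball_vol_ge0// ltW.
apply: (@le_integral_variance Y rho (M%:R / 2) a v _ _
  (fun y => #|` Y|%:R * ball_vol A rho * (ball_ind A x (r - rho) y)%:R)
  (fun y => \sum_(p <- Y) (ball_ind A x r p * ball_ind A y rho p)%:R)) => //.
- by apply: measurable_funM => //; exact: measurable_ball_ind.
- apply: measurable_sum => p; under eq_fun do rewrite natrM.
  by apply: measurable_funM => //; exact: measurable_ball_ind_center.
- by move=> y _; rewrite mulr_ge0.
- by move=> y _; apply: sumr_ge0.
- under eq_integral do rewrite EFinM.
  rewrite ge0_integralZl//; first by rewrite intk// subr_gt0.
  + exact: measurable_fund_domain.
  + by apply/measurable_EFinP; exact: measurable_ball_ind.
- by apply: integral_sum_ball_ind => z; exact: intk.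
- move=> y yO.
  have le1 : (ball_ind A x (r - rho) y)%:R *
        \sum_(p <- Y) (ball_ind A y rho p)%:R <=
      \sum_(p <- Y) (ball_ind A x r p * ball_ind A y rho p)%:R :> R.
    rewrite mulr_sumr; apply: ler_sum => p _.
    by rewrite -natrM ler_nat ball_ind_shift_le_mul.
  apply: le_trans (lerD le1 (lexx _)).
  have le2 := @mul_le_amgm R (ball_ind A x (r - rho) y)%:R M%:R a
    (deviation Y rho y).
  rewrite -[X in _ <= _ * X + _](subrK (#|` Y|%:R * ball_vol A rho)).
  rewrite -/(deviation Y rho y) mulrDr [leLHS]mulrC addrAC lerDr.
  rewrite -lerBlDl sub0r.
  apply: le_trans (le2 _ a0); last by rewrite ler0n ler_nat HM.
  by rewrite -mulrN ler_wpM2l// -normrN ler_norm.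
Qed.

End variance.

(** * The choice of scales and the passage to the limit *)

Lemma rescaled_radius (R : realType) d N (t : R) : (0 < d)%N -> (0 < N)%N ->
  0 < t -> let rho := t * N%:R `^ (- d%:R^-1) in
  0 < rho /\ N%:R * rho ^+ d = t ^+ d.
Proof.
move=> d0 N0 t0 rho; split.
  by rewrite mulr_gt0// powR_gt0// ltr0n.
rewrite exprMn -(powR_mulrn d (powR_ge0 N%:R (- d%:R^-1))) -powRrM mulNr.
rewrite mulVf ?pnatr_eq0 -?lt0n//.
by rewrite powR_inv1// mulrCA mulfV ?mulr1// pnatr_eq0 -lt0n.
Qed.

(** Continuity of [s ^+ d] at [r], with two side conditions for later: [eta <= 1] keeps the outer
    radius below [r + 1], where one bound [M] applies, and [eta < r] keeps the inner radius
    positive. *)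
Lemma near_radius (R : realType) d (r eps kap : R) : 0 < eps -> 0 <= r ->
  exists eta : R, [/\ 0 < eta, eta <= 1, 0 < r -> eta < r &
    forall s, `|s - r| <= eta -> `|kap * s ^+ d - kap * r ^+ d| <= eps].
Proof.
move=> eps0 r0.
have cont : (kap * s ^+ d) @[s --> r] --> kap * r ^+ d.
  by apply: cvgM; [exact: cvg_cst|exact: exprn_continuous].
have /cvgrPdist_le/(_ _ eps0)/nbhs_ballP[e /= e0 He] := cont.
(* The value 1 at [r = 0] keeps the minimum below positive. *)
pose r' := if r == 0 then 1 else r.
have r'0 : 0 < r'.
  by rewrite /r'; case: eqVneq => // rn0; rewrite lt_neqAle eq_sym rn0.
exists (Num.min 1 (Num.min (e / 2) (r' / 2))); split.
- by rewrite !lt_min ltr01 !divr_gt0.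
- by rewrite ge_min lexx.
- move=> rgt0; rewrite !gt_min; apply/orP; right; apply/orP; right.
  by rewrite /r' gt_eqF//; lra.
- move=> s; rewrite !le_min => /and3P[_ se _]; rewrite distrC; apply: He.
  by rewrite /ball/= distrC; lra.
Qed.

Theorem theorem3p3 (R : realType) (d : nat) (A : 'M[R]_d)
    (X : nat -> {fset 'cV[R]_d}) (d_gt0 : (0 < d)%N)
    (A_nonsingular : A \in unitmx) (HX : point_sets A X) :
  hyperuniform_threshold A X -> uniformly_distributed A X.
Proof.
move=> [C HC] x r /andP[r0 _].
have [k k0 intk] := integral_mu_ball_ind A_nonsingular.
have [M HM] := ball_ind_bounded A_nonsingular x (r + 1).
pose kap := ball_vol A 1.
have volE s : ball_vol A s = kap * s ^+ d.
  by rewrite /kap /ball_vol expr1n mulr1.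
have C1 : 0 < `|C| + 1 by rewrite ltr_wpDl.
apply/cvgrPdist_le => eps eps0.
(* Chosen so that for [t >= B] the variance error [M / 2 * (|C| + 2) * t ^+ d.-1], divided by
   [k * t ^+ d], is at most [eps / 2]. The scale [t] is fixed before [N] is taken large. *)
pose B := M%:R * (`|C| + 2) / (k * eps).
have [t [tC t1 tB]] : exists t, [/\ (limn_esup (fun N =>
    number_variance A (X N) (t * N%:R `^ (- d%:R^-1))) <=
    (C * t ^+ d.-1)%:E)%E, 1 <= t & B <= t].
  apply: (@filter_ex _ (pinfty_nbhs R)); near=> t; split; near: t.
  - exact: HC.
  - by apply: nbhs_pinfty_ge; exact: num_real.
  - by apply: nbhs_pinfty_ge; exact: num_real.
have t0 : 0 < t by exact: lt_le_trans t1.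
have a0 : 0 < t ^+ d.-1 by rewrite exprn_gt0.
have tdE : t ^+ d = t * t ^+ d.-1 by rewrite -exprS prednK.
(* Strictly above [C * t ^+ d.-1], so that the bound on the upper limit holds for all large [N]. *)
pose v := (`|C| + 1) * t ^+ d.-1.
have /limn_esup_lt_near nearv : (limn_esup (fun N =>
    number_variance A (X N) (t * N%:R `^ (- d%:R^-1))) < v%:E)%E.
  apply: le_lt_trans tC _; rewrite lte_fin ltr_pM2r//.
  by apply: le_lt_trans (ler_norm C) _; rewrite ltrDl.
(* The AM-GM weight is [t ^+ d.-1] instead of the optimal square root of [v]; the relative error is
   still of order [1 / t]. *)
have error_le : M%:R / 2 * (t ^+ d.-1 + (t ^+ d.-1)^-1 * v) <=
    eps / 2 * (k * t ^+ d).
  rewrite /v [_ * (_ * t ^+ _)]mulrC mulfK ?gt_eqF//.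
  apply: (@le_trans _ _ (M%:R / 2 * ((`|C| + 2) * t ^+ d.-1))).
    rewrite ler_wpM2l ?divr_ge0//.
    have : 1 <= t ^+ d.-1 by rewrite exprn_ege1.
    have := normr_ge0 C; nra.
  move: tB; rewrite /B ler_pdivrMr ?mulr_gt0// => tB.
  rewrite tdE [leLHS]mulrA.
  rewrite (_ : eps / 2 * _ = (t * (k * eps)) / 2 * t ^+ d.-1); last by ring.
  by rewrite ler_pM2r// mulrAC ler_pM2r// invr_gt0.
have [eta [eta0 eta1 etar Heta]] :=
  near_radius d kap (divr_gt0 eps0 (ltr0Sn _ 1)) r0.
near=> N.
have N0 : (0 < N)%N by near: N; exact: nbhs_infty_gt.
have NR0 : 0 < N%:R :> R by rewrite ltr0n.
have [] := rescaled_radius d_gt0 N0 t0.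
set rho := t * _ => rho0 rhoE.
have varN : (number_variance A (X N) rho <= v%:E)%E.
  by rewrite /rho; near: N; exact: nearv.
(* After taking [d]-th powers and using [N * rho ^+ d = t ^+ d], this says that [N] is at least
   [t ^+ d / eta ^+ d]. *)
have rho_eta : rho <= eta.
  rewrite -(@ler_pXn2r _ d) ?nnegrE ?(ltW rho0) ?(ltW eta0)//.
  rewrite -(ler_pM2l NR0) rhoE.
  rewrite -ler_pdivrMr ?exprn_gt0//.
  by near: N; exact: nbhs_infty_ger.
have ball_le s y : s <= r + 1 -> fund_domain A y -> (ball_ind A x s y <= M)%N.
  by move=> sr /HM; apply: leq_trans; exact: ball_ind_le.
have cardXN : #|` X N| = N by have [] := HX N.
set S := \sum_(y <- X N) _.
have S0 : 0 <= S by apply: sumr_ge0.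
have D0 : 0 < k * t ^+ d by rewrite mulr_gt0// exprn_gt0.
have SE : S * (k * rho ^+ d) = N%:R^-1 * S * (k * t ^+ d).
  by rewrite -rhoE; field; rewrite gt_eqF.
(* Here the constants trade places: [kap] moves from the small radius [rho] to [s], and [k] is left
   on [t ^+ d], by which both sides are divided next. Hence [k] and [kap] need not be related. *)
have mainE s : N%:R * (kap * rho ^+ d) * (k * s ^+ d) =
    kap * s ^+ d * (k * t ^+ d) by rewrite -rhoE; ring.
have upper : N%:R^-1 * S <= kap * (r + rho) ^+ d + eps / 2.
  rewrite -(ler_pM2r D0) -SE mulrDl -mainE.
  apply: (@le_trans _ _ (N%:R * (kap * rho ^+ d) * (k * (r + rho) ^+ d) +
    M%:R / 2 * (t ^+ d.-1 + (t ^+ d.-1)^-1 * v))); last by rewrite lerD2l.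
  have := @sum_ball_ind_upper R d A A_nonsingular k (X N) x r rho M
    (t ^+ d.-1) v intk r0 rho0.
  rewrite cardXN volE; apply => // y; apply: ball_le.
  by rewrite lerD2l (le_trans rho_eta).
have lower : 0 < r -> kap * (r - rho) ^+ d <= N%:R^-1 * S + eps / 2.
  move=> rgt0.
  rewrite -(ler_pM2r D0) -mainE mulrDl -SE.
  apply: (@le_trans _ _ (S * (k * rho ^+ d) +
    M%:R / 2 * (t ^+ d.-1 + (t ^+ d.-1)^-1 * v))); last by rewrite lerD2l.
  have := @sum_ball_ind_lower R d A A_nonsingular k (X N) x r rho M
    (t ^+ d.-1) v intk rho0 (le_lt_trans rho_eta (etar rgt0)).
  rewrite cardXN volE; apply => // y; apply: ball_le.
  by rewrite lerD2l; lra.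
have /ler_normlP[_ Hu] : `|kap * (r + rho) ^+ d - kap * r ^+ d| <= eps / 2.
  by apply: Heta; rewrite addrAC subrr add0r gtr0_norm.
rewrite volE; apply/ler_normlP; split; first lra.
have [rgt0|rle0] := ltP 0 r.
  have /ler_normlP[Hl _] : `|kap * (r - rho) ^+ d - kap * r ^+ d| <= eps / 2.
    by apply: Heta; rewrite addrAC subrr sub0r normrN gtr0_norm.
  by have := lower rgt0; lra.
have -> : r = 0 by apply/eqP; rewrite eq_le rle0.
rewrite expr0n -(prednK d_gt0)/= mulr0 sub0r.
have : 0 <= N%:R^-1 * S by rewrite mulr_ge0.
by lra.
Unshelve. all: by end_near. Qed.
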